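(* Let $Q$ be a loop. For a commutator term $c=\llbracket x,y\rrbracket$ and an associator term $a=\llbracket x,y,z\rrbracket$ let $\mathcal I_{c,a}$ denote the following set of identities: \begin{align*} 1&=\llbracket x,\llbracket y,u,v\rrbracket\rrbracket,\\ 1&=\llbracket x,y,\llbracket u,v,w\rrbracket\rrbracket=\llbracket x,\llbracket u,v,w\rrbracket,y\rrbracket=\llbracket\llbracket u,v,w\rrbracket,x,y\rrbracket,\\ 1&=\llbracket x,y,\llbracket u,v\rrbracket\rrbracket=\llbracket x,\llbracket u,v\rrbracket,y\rrbracket=\llbracket\llbracket u,v\rrbracket,x,y\rrbracket,\\ 1&=\llbracket x,\llbracket y,\llbracket u,v\rrbracket\rrbracket\rrbracket=\llbracket x,\llbracket\llbracket u,v\rrbracket,y\rrbracket\rrbracket,\\ 1&=\llbracket\llbracket y,\llbracket u,v\rrbracket\rrbracket,x\rrbracket=\llbracket\llbracket\llbracket u,v\rrbracket,y\rrbracket,x\rrbracket,\\ 1&=\llbracket\llbracket x,y\rrbracket,\llbracket u,v\rrbracket\rrbracket,\\ \llbracket xy,u,v\rrbracket&=\llbracket x,u,v\rrbracket\,\llbracket y,u,v\rrbracket,\\ \llbracket u,xy,v\rrbracket&=\llbracket u,x,v\rrbracket\,\llbracket u,y,v\rrbracket,\\ \llbracket u,v,xy\rrbracket&=\llbracket u,v,x\rrbracket\,\llbracket u,v,y\rrbracket. \end{align*} The following conditions are equivalent: (i) $Q$ is $3$-supernilpotent; (ii) $Q$ satisfies the identities $\mathcal I_{c,a}$ for every choice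 of commutator term $c$ and associator term $a$; (iii) $Q$ satisfies the identities $\mathcal I_{c,a}$ where $c$ is the standard commutator term and $a$ is the standard associator term.
   Context: A loop is an algebra $(Q,\cdot,\backslash,/,1)$ in which $1$ is a two-sided identity for $\cdot$, $a\backslash b$ is the unique solution $x$ of $ax=b$, and $b/a$ is the unique solution $x$ of $xa=b$. Terms are in the language $\{\cdot,\backslash,/,1\}$. A commutator term is a binary loop term $\llbracket x,y\rrbracket$ such that for all elements $a,b$ of every loop, $\llbracket a,b\rrbracket=1$ if and only if $ab=ba$. An associator term is a ternary loop term $\llbracket x,y,z\rrbracket$ such that for all elements $a,b,c$ of every loop, $\llbracket a,b,c\rrbracket=1$ if and only if $a(bc)=(ab)c$. The standard commutator term is $[x,y]=(yx)\backslash(xy)$ and the standard associator term is $[x,y,z]=(x(yz))\backslash((xy)z)$. A polynomial on an algebra $A$ is a term in the language of $A$ expanded by all elements of $A$ as constants. An $n$-ary polynomial $p$ on $A$ is absorbing at $(e_1,\dots,e_n)\in A^n$ into $e\in A$ if $p(a_1,\dots,a_n)=e$ whenever $a_1,\dots,a_n\in A$ satisfy $a_i=e_i$ for at least one $i$. The algebra $A$ is $k$-supernilpotent if all polynomials on $A$ in at least $k+1$ variables that are absorbing (at any tuple and into any element) are constant (as functions). *)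

(* Defs.v *)
From HB Require Import structures.
From mathcomp Require Import all_boot.
From mathcomp Require Import monoid.

Set Implicit Arguments.
Unset Strict Implicit.
Unset Printing Implicit Defensive.

Local Open Scope group_scope.

(* Built on [BaseUMagma] rather than [UMagma], because the latter would add a
   choice operator on the carrier. *)
HB.mixin Record BaseUMagma_isLoop Q of BaseUMagma Q := {
  ldiv : Q -> Q -> Q;
  rdiv : Q -> Q -> Q;
  mul1q : forall a : Q, 1 * a = a;
  mulq1 : forall a : Q, a * 1 = a;
  ldivP : forall a b x : Q, a * x = b <-> x = ldiv a b;
  rdivP : forall a b x : Q, x * a = b <-> x = rdiv b a
}.

#[short(type="loopType")]
HB.structure Definition Loop := {Q of BaseUMagma_isLoop Q & BaseUMagma Q}.

(* Terms in n variables in the language of loops expanded by constants in C. *)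
Inductive term (C : Type) (n : nat) : Type :=
| Var of 'I_n
| Const of C
| One
| Mul of term C n & term C n
| LDiv of term C n & term C n
| RDiv of term C n & term C n.

Arguments Var {C n}.
Arguments Const {C n}.
Arguments One {C n}.

Fixpoint eval (Q : loopType) (C : Type) (n : nat) (const : C -> Q)
    (env : 'I_n -> Q) (t : term C n) : Q :=
  match t with
  | Var i => env i
  | Const q => const q
  | One => 1
  | Mul s t => eval const env s * eval const env t
  | LDiv s t => ldiv (eval const env s) (eval const env t)
  | RDiv s t => rdiv (eval const env s) (eval const env t)
  end.

Definition loop_term (n : nat) : Type := term void n.

Definition eval2 (Q : loopType) (c : loop_term 2) (x y : Q) : Q :=
  eval (of_void Q) (tnth [tuple x; y]) c.

Definition eval3 (Q : loopType) (a : loop_term 3) (x y z : Q) : Q :=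
  eval (of_void Q) (tnth [tuple x; y; z]) a.

Definition commutator_term (c : loop_term 2) : Prop :=
  forall (Q : loopType) (a b : Q), eval2 c a b = 1 <-> a * b = b * a.

Definition associator_term (t : loop_term 3) : Prop :=
  forall (Q : loopType) (a b c : Q),
    eval3 t a b c = 1 <-> a * (b * c) = (a * b) * c.

Definition std_commutator : loop_term 2 :=
  let x := Var (@Ordinal 2 0 isT) in
  let y := Var (@Ordinal 2 1 isT) in
  LDiv (Mul y x) (Mul x y).

Definition std_associator : loop_term 3 :=
  let x := Var (@Ordinal 3 0 isT) in
  let y := Var (@Ordinal 3 1 isT) in
  let z := Var (@Ordinal 3 2 isT) in
  LDiv (Mul x (Mul y z)) (Mul (Mul x y) z).

Lemma std_commutatorE (Q : loopType) (x y : Q) :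
  eval2 std_commutator x y = ldiv (y * x) (x * y).
Proof. by []. Qed.

Lemma std_associatorE (Q : loopType) (x y z : Q) :
  eval3 std_associator x y z = ldiv (x * (y * z)) ((x * y) * z).
Proof. by []. Qed.

Definition polynomial (Q : loopType) (n : nat) : Type := term Q n.

Definition peval (Q : loopType) (n : nat) (p : polynomial Q n) (a : 'I_n -> Q)
  : Q := eval id a p.

Definition absorbing (Q : loopType) (n : nat) (p : polynomial Q n)
    (e : 'I_n -> Q) (e0 : Q) : Prop :=
  forall a : 'I_n -> Q, (exists i, a i = e i) -> peval p a = e0.

Definition supernilpotent (k : nat) (Q : loopType) : Prop :=
  forall (n : nat) (p : polynomial Q n) (e : 'I_n -> Q) (e0 : Q),
    k < n -> absorbing p e e0 -> exists q : Q, forall a, peval p a = q.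

Definition satisfies_identities (Q : loopType)
    (c : loop_term 2) (a : loop_term 3) : Prop :=
  let C := @eval2 Q c in
  let A := @eval3 Q a in
  forall x y u v w : Q,
    1 = C x (A y u v)
    /\ (1 = A x y (A u v w) /\ 1 = A x (A u v w) y /\ 1 = A (A u v w) x y)
    /\ (1 = A x y (C u v) /\ 1 = A x (C u v) y /\ 1 = A (C u v) x y)
    /\ (1 = C x (C y (C u v)) /\ 1 = C x (C (C u v) y))
    /\ (1 = C (C y (C u v)) x /\ 1 = C (C (C u v) y) x)
    /\ 1 = C (C x y) (C u v)
    /\ A (x * y) u v = A x u v * A y u v
    /\ A u (x * y) v = A u x v * A u y v
    /\ A u v (x * y) = A u v x * A u v y.

(* Main.v *)
(* (i) => (ii): the difference of the two sides of each identity is a 4-ary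
   polynomial (freezing [w] if needed) that absorbs 1 into 1.

   (iii) => (i): under the standard identities, Q = P_0 = P_1 > P_2 > P_3 =
   center > P_4 = 1 is a filtration with [P_i, P_j] in P_(i+j) and
   [P_i, P_j, P_k] in P_(i+j+k). Whenever P is such a filtration, so is
   i |-> {(a, a b) | a in P_i, b in P_(i+1)} on the square of the loop, as in
   the Host-Kra cube construction for groups. Iterating four times, the 16
   values of a polynomial at the vertices of a 4-dimensional combinatorial cube
   of arguments form an element of the resulting P_0. If 15 of these values are
   equal, taking successive differences shows that the last one differs from
   them by an element of P_4 = 1. *)

From HB Require Import structures.
Require Import Defs.
From mathcomp Require Import all_boot zify.
From mathcomp Require Import monoid.

Set Implicit Arguments.
Unset Strict Implicit.
Unset Printing Implicit Defensive.

Local Open Scope group_scope.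

(** * Commutators, associators, nucleus and center *)

Definition cm (Q : loopType) (x y : Q) : Q := ldiv (y * x) (x * y).
Definition asc (Q : loopType) (x y z : Q) : Q :=
  ldiv (x * (y * z)) (x * y * z).
Definition rinv (Q : loopType) (x : Q) : Q := ldiv x 1.

Definition nuclear (Q : loopType) (n : Q) : Prop :=
  forall x y : Q,
    [/\ n * x * y = n * (x * y), x * n * y = x * (n * y)
      & x * y * n = x * (y * n)].

Definition central (Q : loopType) (z : Q) : Prop :=
  nuclear z /\ forall x, z * x = x * z.

Section Loop.
Variable Q : loopType.
Implicit Types x y z n m : Q.

Lemma mulqK x y : x * ldiv x y = y.
Proof. by apply/ldivP. Qed.

Lemma divqK x y : rdiv y x * x = y.
Proof. by apply/rdivP. Qed.

Lemma mulqI x y z : x * y = x * z -> y = z.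
Proof. by move/ldivP->; symmetry; apply/ldivP. Qed.

Lemma mulIq x y z : y * x = z * x -> y = z.
Proof. by move/rdivP->; symmetry; apply/rdivP. Qed.

Lemma mulqV x : x * rinv x = 1.
Proof. exact: mulqK. Qed.

Lemma cmE x y : x * y = y * x * cm x y.
Proof. by rewrite mulqK. Qed.

Lemma ascE x y z : x * y * z = x * (y * z) * asc x y z.
Proof. by rewrite mulqK. Qed.

Lemma ldiv_eq1 x y : ldiv x y = 1 <-> x = y.
Proof.
split=> [xy1|->]; first by rewrite -[RHS](mulqK x) xy1 mulq1.
by symmetry; apply/ldivP; rewrite mulq1.
Qed.

Lemma cm_eq1 x y : cm x y = 1 <-> x * y = y * x.
Proof. by split=> [/ldiv_eq1|/esym] // /ldiv_eq1. Qed.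

Lemma asc_eq1 x y z : asc x y z = 1 <-> x * y * z = x * (y * z).
Proof. by split=> [/ldiv_eq1|/esym] // /ldiv_eq1. Qed.

Lemma nuclear_asc n :
  (forall x y, [/\ asc n x y = 1, asc x n y = 1 & asc x y n = 1]) <-> nuclear n.
Proof.
split=> nn x y; have [h1 h2 h3] := nn x y;
  by split; apply/asc_eq1 || apply/asc_eq1.
Qed.

Lemma nucl n x y : nuclear n -> n * x * y = n * (x * y).
Proof. by move=> /(_ x y) []. Qed.

Lemma nucm n x y : nuclear n -> x * n * y = x * (n * y).
Proof. by move=> /(_ x y) []. Qed.

Lemma nucr n x y : nuclear n -> x * y * n = x * (y * n).
Proof. by move=> /(_ x y) []. Qed.

Lemma nuclear1 : nuclear (1 : Q).
Proof. by move=> x y; rewrite !mul1q !mulq1. Qed.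

Lemma nuclearM n m : nuclear n -> nuclear m -> nuclear (n * m).
Proof.
move=> nn nm x y; split.
- by rewrite !(nucl _ _ nn) (nucl _ _ nm).
- by rewrite (nucl _ _ nn) -!(nucm _ _ nn) (nucm _ _ nm).
- by rewrite -!(nucr _ _ nm) (nucr _ _ nn).
Qed.

Lemma central1 : central (1 : Q).
Proof. by split=> [|x]; [exact: nuclear1 | rewrite mul1q mulq1]. Qed.

Lemma centralM z z' : central z -> central z' -> central (z * z').
Proof.
move=> [nz cz] [nz' cz']; split=> [|x]; first exact: nuclearM.
by rewrite (nucl _ _ nz) cz' -(nucl _ _ nz) cz (nucm _ _ nz).
Qed.

Lemma commM n m x :
  nuclear n -> n * x = x * n -> m * x = x * m -> n * m * x = x * (n * m).
Proof.
by move=> nn nx mx; rewrite (nucl _ _ nn) mx -(nucl _ _ nn) nx (nucm _ _ nn).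
Qed.

Lemma commV n x : nuclear n -> n * x = x * n -> rinv n * x = x * rinv n.
Proof.
move=> nn nx; apply: (@mulqI n).
by rewrite -!(nucl _ _ nn) nx (nucm _ _ nn) mulqV mul1q mulq1.
Qed.

End Loop.

(** * Commutator calculus under the standard identities *)

Record nil3 (Q : loopType) : Prop := Nil3 {
  asc_central : forall x y z : Q, central (asc x y z);
  cm_nuclear : forall x y : Q, nuclear (cm x y);
  cmc_central : forall x y z : Q, central (cm (cm x y) z);
  cm_comm : forall x y z t : Q, cm x y * cm z t = cm z t * cm x y;
  ascMl : forall x y u v : Q, asc (x * y) u v = asc x u v * asc y u v;
  ascMm : forall x y u v : Q, asc u (x * y) v = asc u x v * asc u y v;
  ascMr : forall x y u v : Q, asc u v (x * y) = asc u v x * asc u v y }.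

(** An element is nuclear when its associators vanish in all three positions; trivial commutators
    then upgrade nuclear to central. *)
Lemma nil3P (Q : loopType) :
  satisfies_identities Q std_commutator std_associator -> nil3 Q.
Proof.
move=> H.
have nA (x y z : Q) : nuclear (asc x y z).
  apply/nuclear_asc => s t.
  by have [_ [[e1 [e2 e3]] _]] := H s t x y z; split; symmetry.
have nC (x y : Q) : nuclear (cm x y).
  apply/nuclear_asc => s t.
  by have [_ [_ [[e1 [e2 e3]] _]]] := H s t x y 1; split; symmetry.
split=> //.
- move=> x y z; split=> // s; apply/esym/cm_eq1/esym.
  by have [] := H s x y z 1.
- move=> u v y; split=> // x; apply/cm_eq1/esym.
  by have [_ [_ [_ [_ [[]]]]]] := H x y u v 1.
- move=> x y u v; apply/cm_eq1/esym.
  by have [_ [_ [_ [_ [_ []]]]]] := H x y u v 1.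
- by move=> x y u v; have [_ [_ [_ [_ [_ [_ []]]]]]] := H x y u v 1.
- by move=> x y u v; have [_ [_ [_ [_ [_ [_ [_ []]]]]]]] := H x y u v 1.
- by move=> x y u v; have [_ [_ [_ [_ [_ [_ [_ []]]]]]]] := H x y u v 1.
Qed.

Section Nil3.
Variables (Q : loopType) (HQ : nil3 Q).
Implicit Types x y z n m : Q.

Lemma asc_nuclear x y z : nuclear (asc x y z).
Proof. by case: (asc_central HQ x y z). Qed.

Lemma asc_comm x y z t : asc x y z * t = t * asc x y z.
Proof. by case: (asc_central HQ x y z). Qed.

Lemma asc1l x y : asc 1 x y = 1 :> Q.
Proof. by apply/asc_eq1; rewrite !mul1q. Qed.

Lemma asc1m x y : asc x 1 y = 1 :> Q.
Proof. by apply/asc_eq1; rewrite mul1q mulq1. Qed.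

Lemma asc1r x y : asc x y 1 = 1 :> Q.
Proof. by apply/asc_eq1; rewrite !mulq1. Qed.

Lemma ascV x y z : asc x y z * asc (rinv x) y z = 1.
Proof. by rewrite -(ascMl HQ) mulqV asc1l. Qed.

(** Additivity makes [asc (rinv x) y z] the inverse of [asc x y z], so moving parentheses to the
    left also costs just an associator. *)
Lemma ascVE x y z : x * (y * z) = x * y * z * asc (rinv x) y z.
Proof. by rewrite (ascE x y z) (nucm _ _ (asc_nuclear _ _ _)) ascV mulq1. Qed.

Lemma asc_swap x y z s t : s * asc x y z * t = s * t * asc x y z.
Proof.
by rewrite (nucm _ _ (asc_nuclear _ _ _)) asc_comm (nucr _ _ (asc_nuclear _ _ _)).
Qed.

Lemma cmV x y : cm x y * cm y x = 1.
Proof.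
apply: (@mulqI _ (y * x)).
by rewrite -(nucm _ _ (cm_nuclear HQ _ _)) -cmE -cmE mulq1.
Qed.

(** Move [z] leftwards past [y], then past [x]: each swap costs a commutator and each regrouping an
    associator. Commutators are nuclear and associators central, so the costs collect on the
    right. *)
Lemma cmMl x y z :
  cm (x * y) z = cm x z * (cm (cm x z) y * (cm y z *
    (asc x y z * (asc (rinv x) z y * asc z x y)))).
Proof.
apply: (@mulqI _ (z * (x * y))); rewrite -cmE.
have nC s t := cm_nuclear HQ s t; have nA s t u := asc_nuclear s t u.

rewrite (ascE x y z) (cmE y z) -(nucr _ _ (nC _ _)) (ascVE x z y) (cmE x z).
rewrite (nucm _ _ (nC x z)) (cmE (cm x z) y).
rewrite -?(nucr _ _ (nC _ _)) -?(nucr _ _ (nA _ _ _)).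
rewrite -?(nucr _ _ (nC _ _)).
by rewrite (ascE z x y) !(asc_swap z x y) !(asc_swap (rinv x) z y).
Qed.

(** Serves closure of cubes under products: [(a, a * b)] times [(d, d * w)] has first coordinate
    [a * d], so the second must be [a * d] times an error term. *)
Lemma mulMM (a b d w : Q) : a * b * (d * w) =
  a * d * (b * (cm b d * w) * (asc (a * d) b (cm b d * w) *
    (asc a b d * (asc (rinv a) d b * asc (rinv (a * b)) d w)))).
Proof.
have nC s t := cm_nuclear HQ s t; have nA (s t u : Q) := asc_nuclear s t u.
rewrite -!(nucr _ _ (nA _ _ _)) -ascE -(nucm _ _ (nC b d)).
rewrite (ascVE (a * b)) (ascE a b d) (cmE b d) -(nucr _ _ (nC _ _)) (ascVE a d b).
by rewrite !(asc_swap (rinv a) d b) !(asc_swap a b d).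
Qed.

(** By additivity, the associators of [n] and [rinv n] in any one position multiply to an associator
    with entry 1. *)
Lemma nuclearV n : nuclear n -> nuclear (rinv n).
Proof.
move=> nn; apply/nuclear_asc => x y.
have [e1 e2 e3] := proj2 (nuclear_asc n) nn x y; split.
- by have := ascMl HQ n (rinv n) x y; rewrite mulqV asc1l e1 mul1q.
- by have := ascMm HQ n (rinv n) x y; rewrite mulqV asc1m e2 mul1q.
- by have := ascMr HQ n (rinv n) x y; rewrite mulqV asc1r e3 mul1q.
Qed.

Lemma centralV z : central z -> central (rinv z).
Proof.
by move=> [nz cz]; split=> [|x]; [exact: nuclearV | exact: commV].
Qed.

Lemma rinv_uniq x y : x * y = 1 -> y = rinv x.
Proof. by move=> xy; apply: (@mulqI _ x); rewrite mulqV. Qed.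

(** With [rdivE], this reduces closure under the divisions to closure under products, [rinv] and
    associators. *)
Lemma ldivE x y : ldiv x y = rinv x * y * asc x (rinv x) y.
Proof.
apply: (@mulqI _ x); rewrite mulqK.
by rewrite -(nucr _ _ (asc_nuclear _ _ _)) -ascE mulqV mul1q.
Qed.

Lemma mulVq x : rinv x * x = rinv (asc x (rinv x) x).
Proof.
apply: rinv_uniq; rewrite asc_comm; apply: (@mulqI _ x).
by rewrite -(nucr _ _ (asc_nuclear _ _ _)) -ascE mulqV mul1q mulq1.
Qed.

Lemma rdivE x y :
  rdiv y x = y * rinv x * (rinv (asc y (rinv x) x) * asc x (rinv x) x).
Proof.
apply: (@mulIq _ x); rewrite divqK.
set A := asc x _ _; set B := asc y _ _.
have nA : nuclear A by exact: asc_nuclear.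
have nB : nuclear (rinv B) by apply/nuclearV/asc_nuclear.
have BAx : rinv B * A * x = x * (rinv B * A).
  by apply: commM => //; [apply: commV; [exact: asc_nuclear|] |]; exact: asc_comm.
rewrite (nucm _ _ (nuclearM nB nA)) BAx -(nucr _ _ (nuclearM nB nA)).
rewrite (ascE y) mulVq -/A -/B -[in RHS](nucr _ _ nA).
rewrite [_ * B * rinv B](nucr _ _ nB) mulqV mulq1.
by rewrite (nucr _ _ nA) (commV nA) ?mulqV ?mulq1 // asc_comm.
Qed.
End Nil3.

(** * Filtrations, and how operations react to perturbations one level deeper *)

Record filtration (Q : loopType) (P : nat -> Q -> Prop) : Prop := Filtration {
  fil_mono : forall i j x, j <= i -> P i x -> P j x;
  fil1 : forall i, P i 1;
  filM : forall i x y, P i x -> P i y -> P i (x * y);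
  filV : forall i x, P i x -> P i (rinv x);
  fil_cm : forall i j k x y, k <= i + j -> P i x -> P j y -> P k (cm x y);
  fil_asc : forall i j l k x y z, k <= i + j + l ->
    P i x -> P j y -> P l z -> P k (asc x y z) }.

Section Filtration.
Variables (Q : loopType) (HQ : nil3 Q) (P : nat -> Q -> Prop).
Hypothesis HP : filtration P.
Implicit Types x y z a b d w : Q.

Lemma filD i x y : P i x -> P i y -> P i (ldiv x y).
Proof.
move=> px py; rewrite (ldivE HQ).
apply: (filM HP); first by apply: (filM HP) => //; apply: (filV HP).
by apply: (fil_asc HP _ px (filV HP px) py); lia.
Qed.

Lemma filR i x y : P i x -> P i y -> P i (rdiv y x).
Proof.
move=> px py; have pv := filV HP px; rewrite (rdivE HQ).
apply: (filM HP); first exact: (filM HP).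
apply: (filM HP).
  by apply: (filV HP); apply: (fil_asc HP _ py pv px); lia.
by apply: (fil_asc HP _ px pv px); lia.
Qed.

(** The associators of [mulMM] are split off as a central [t], so that [fil_rinvM] can cancel it. *)
Lemma fil_mulMM i a b d w :
    P i a -> P i.+1 b -> P i d -> P i.+1 w ->
  exists2 t, P i.+1 t /\ central t
           & a * b * (d * w) = a * d * (b * (cm b d * w) * t).
Proof.
move=> pa pb pd pw; have pb' := fil_mono HP (leqnSn i) pb.
have pcw : P i.+1 (cm b d * w).
  by apply: (filM HP) => //; apply: (fil_cm HP _ pb pd); lia.
eexists; last exact: mulMM; split.
  apply: (filM HP); first by apply: (fil_asc HP _ (filM HP pa pd) pb pcw); lia.
  apply: (filM HP); first by apply: (fil_asc HP _ pa pb pd); lia.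
  apply: (filM HP); first by apply: (fil_asc HP _ (filV HP pa) pd pb); lia.
  by apply: (fil_asc HP _ (filV HP (filM HP pa pb')) pd pw); lia.
by do ![apply: centralM | exact: asc_central HQ _ _ _].
Qed.

(** Every factor of [cmMl] beyond [cm a z] involves [b], which lies one level deeper than [a]. *)
Lemma fil_cmMl i j a b z : P i a -> P i.+1 b -> P j z ->
  exists2 w, P (i + j).+1 w & cm (a * b) z = cm a z * w.
Proof.
move=> pa pb pz; eexists; last exact: cmMl.
apply: (filM HP).
  have pc : P (i + j) (cm a z) by apply: (fil_cm HP _ pa pz).
  by apply: (fil_cm HP _ pc pb); lia.
apply: (filM HP); first by apply: (fil_cm HP _ pb pz); lia.
apply: (filM HP); first by apply: (fil_asc HP _ pa pb pz); lia.
apply: (filM HP); first by apply: (fil_asc HP _ (filV HP pa) pz pb); lia.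
by apply: (fil_asc HP _ pz pa pb); lia.
Qed.

Lemma fil_cmMr i j a b z : P i a -> P i.+1 b -> P j z ->
  exists2 w, P (i + j).+1 w & cm z (a * b) = cm z a * w.
Proof.
move=> pa pb pz; have [w pw e] := fil_cmMl pa pb pz.
have nC x y := cm_nuclear HQ x y.
have nw : nuclear w.
  have -> : w = cm z a * cm (a * b) z.
    by rewrite e -(nucl _ _ (nC z a)) (cmV HQ) mul1q.
  exact: nuclearM.
(* Inverting [cm a z * w] gives [rinv w * cm z a]; swapping these two factors costs the last
   commutator. *)
exists (rinv w * cm (rinv w) (cm z a)); last first.
  rewrite -(nucr _ _ (nC _ _)) -cmE [LHS](rinv_uniq (cmV HQ _ _)) e.
  symmetry; apply: rinv_uniq.
  by rewrite (nucl _ _ (nC _ _)) -(nucl _ _ nw) mulqV mul1q (cmV HQ).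
have pv : P (i + j).+1 (rinv w) by exact: (filV HP).
apply: (filM HP) => //.
have pc : P 0 (cm z a) by apply: (fil_cm HP _ pz pa).
by apply: (fil_cm HP _ pv pc); lia.
Qed.

Lemma fil_rinvM i a b : P i a -> P i.+1 b ->
  exists2 w, P i.+1 w & rinv (a * b) = rinv a * w.
Proof.
move=> pa pb; have pa' := filV HP pa.
(* Chosen so that [b * (c * w) = 1]; then [a * b * (rinv a * w)] is the central [t], and [rinv t]
   corrects it. *)
set c := cm b (rinv a); set w := rinv c * rinv b.
have pc : P i.+1 c by apply: (fil_cm HP _ pb pa'); lia.
have pw : P i.+1 w by apply: (filM HP); apply: (filV HP).
have [t [pt ct] e] := fil_mulMM pa pb pa' pw.
have nt := nuclearV HQ (proj1 ct).
exists (w * rinv t); first by apply: (filM HP) => //; apply: (filV HP).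
symmetry; apply: rinv_uniq; rewrite -!(nucr _ _ nt) e -/c mulqV mul1q.
rewrite /w -(nucl _ _ (cm_nuclear HQ _ _)) mulqV mul1q mulqV mul1q.
exact: mulqV.
Qed.

(** Expand by additivity in each position: every term except [asc a d f] involves one of the deeper
    elements [b], [e], [g]. *)
Lemma fil_ascM i j l a b d e f g :
    P i a -> P i.+1 b -> P j d -> P j.+1 e -> P l f -> P l.+1 g ->
  exists2 w, P (i + j + l).+1 w
           & asc (a * b) (d * e) (f * g) = asc a d f * w.
Proof.
move=> pa pb pd pe pf pg.
have nA (x y z : Q) := asc_nuclear HQ x y z.
exists (asc a d g * (asc a e (f * g) * asc b (d * e) (f * g))); last first.
  rewrite (ascMl HQ) {1}(ascMm HQ) {1}(ascMr HQ).
  by rewrite !(nucl _ _ (nA a _ _)).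
have pde := filM HP pd (fil_mono HP (leqnSn j) pe).
have pfg := filM HP pf (fil_mono HP (leqnSn l) pg).
apply: (filM HP); first by apply: (fil_asc HP _ pa pd pg); lia.
apply: (filM HP); first by apply: (fil_asc HP _ pa pe pfg); lia.
by apply: (fil_asc HP _ pb pde pfg); lia.
Qed.

End Filtration.

(** * Direct products of loops *)

Section PairLoop.
Variables Q1 Q2 : loopType.

Definition pair_ldiv (a b : Q1 * Q2) := (ldiv a.1 b.1, ldiv a.2 b.2).
Definition pair_rdiv (b a : Q1 * Q2) := (rdiv b.1 a.1, rdiv b.2 a.2).

Fact pair_mul1q (a : Q1 * Q2) : 1 * a = a.
Proof. by case: a => a1 a2; congr pair; exact: mul1q. Qed.

Fact pair_mulq1 (a : Q1 * Q2) : a * 1 = a.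
Proof. by case: a => a1 a2; congr pair; exact: mulq1. Qed.

Fact pair_ldivP (a b x : Q1 * Q2) : a * x = b <-> x = pair_ldiv a b.
Proof.
case: a b x => [a1 a2] [b1 b2] [x1 x2]; split=> [[<- <-]|[-> ->]].
  by congr pair; apply/ldivP.
by congr pair; apply: mulqK.
Qed.

Fact pair_rdivP (a b x : Q1 * Q2) : x * a = b <-> x = pair_rdiv b a.
Proof.
case: a b x => [a1 a2] [b1 b2] [x1 x2]; split=> [[<- <-]|[-> ->]].
  by congr pair; apply/rdivP.
by congr pair; apply: divqK.
Qed.

HB.instance Definition _ := BaseUMagma_isLoop.Build (Q1 * Q2)%type
  pair_mul1q pair_mulq1 pair_ldivP pair_rdivP.

Lemma nuclear_pair (n : Q1 * Q2) : nuclear n.1 -> nuclear n.2 -> nuclear n.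
Proof.
move=> n1 n2 x y; have [a1 a2 a3] := n1 x.1 y.1; have [b1 b2 b3] := n2 x.2 y.2.
by split; congr pair.
Qed.

Lemma central_pair (n : Q1 * Q2) : central n.1 -> central n.2 -> central n.
Proof.
move=> [n1 c1] [n2 c2]; split; first exact: nuclear_pair.
by move=> x; congr pair.
Qed.

Lemma nil3_pair : nil3 Q1 -> nil3 Q2 -> nil3 (Q1 * Q2)%type.
Proof.
move=> H1 H2; split=> *.
- by apply: central_pair; exact: asc_central.
- by apply: nuclear_pair; exact: cm_nuclear.
- by apply: central_pair; exact: cmc_central.
- by congr pair; exact: cm_comm.
- by congr pair; exact: ascMl.
- by congr pair; exact: ascMm.
- by congr pair; exact: ascMr.
Qed.

Lemma eval_pair (C : Type) n (const : C -> Q1 * Q2) (env : 'I_n -> Q1 * Q2) t :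
  eval const env t = (eval (fst \o const) (fst \o env) t,
                      eval (snd \o const) (snd \o env) t).
Proof.
elim: t => //= [i|q|s -> t ->|s -> t ->|s -> t ->] //.
- by case: (env i).
- by case: (const q).
Qed.

End PairLoop.

Lemma eq_eval (Q : loopType) (C : Type) n (const const' : C -> Q)
    (env env' : 'I_n -> Q) t :
  const =1 const' -> env =1 env' -> eval const env t = eval const' env' t.
Proof.
move=> ec ee; elim: t => //= s IHs t IHt; by rewrite IHs IHt.
Qed.

(** * The cube filtration on the square of a loop *)

Definition cube (Q : loopType) (P : nat -> Q -> Prop) (i : nat) (z : Q * Q) :=
  P i z.1 /\ exists2 w, P i.+1 w & z.2 = z.1 * w.

Section Cube.
Variables (Q : loopType) (HQ : nil3 Q) (P : nat -> Q -> Prop).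
Hypothesis HP : filtration P.

Lemma cube_diag i x : P i x -> cube P i (x, x).
Proof. by split=> //; exists 1; [exact: fil1 | rewrite /= mulq1]. Qed.

(** The first coordinates satisfy each condition because [P] does; the perturbation lemmas above put
    the quotients of the second by the first coordinates one level deeper. *)
Lemma cube_filtration : filtration (cube P).
Proof.
split.
- move=> i j x ji [p1 [w pw e]]; split; first exact: fil_mono p1.
  by exists w => //; apply: fil_mono pw.
- by move=> i; apply: cube_diag; exact: fil1.
- move=> i [a _] [d _] [/= pa [b pb ->]] [/= pd [w pw ->]].
  split; first exact: filM.
  have [t [pt _] e] := fil_mulMM HQ HP pa pb pd pw.
  exists (b * (cm b d * w) * t); last exact: e.
  do ![apply: (filM HP) => //].
  by apply: (fil_cm HP _ pb pd); lia.
- move=> i [a _] [/= pa [b pb ->]].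
  split; first exact: filV.
  exact: fil_rinvM.
- move=> i j k [a _] [d _] le_k [/= pa [b pb ->]] [/= pd [e pe ->]].
  split; first exact: fil_cm pa pd.
  have pde := filM HP pd (fil_mono HP (leqnSn j) pe).
  (* Perturb one argument at a time: first [a] against [d * e], then [d] against the unperturbed
     [a]. *)
  have [v pv ev] := fil_cmMl HQ HP pa pb pde.
  have [w pw ew] := fil_cmMr HQ HP pd pe pa.
  exists (w * v).
    rewrite addnC in pw; apply: (@fil_mono _ _ HP (i + j).+1) => //.
    exact: (filM HP).
  have -> : cm (a, a * b) (d, d * e) = (cm a d, cm (a * b) (d * e)) by [].
  by rewrite /= ev ew (nucl _ _ (cm_nuclear HQ _ _)).
- move=> i j l k [a _] [d _] [f _] le_k
    [/= pa [b pb ->]] [/= pd [e pe ->]] [/= pf [g pg ->]].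
  split; first exact: fil_asc pa pd pf.
  have [w pw ew] := fil_ascM HQ HP pa pb pd pe pf pg.
  by exists w => //; apply: fil_mono pw.
Qed.

(** Taking a difference trades one dimension of the cube for one level of the filtration. *)
Lemma cubeE i x y : cube P i (x, y) <-> P i x /\ P i.+1 (ldiv x y).
Proof.
split=> [[px [w pw /= ->]]|[px pw]]; split=> //.
  by have -> : ldiv x (x * w) = w by apply: (@mulqI _ x); rewrite mulqK.
by exists (ldiv x y); rewrite /= ?mulqK.
Qed.

End Cube.

Lemma fil_eval (Q : loopType) (HQ : nil3 Q) (P : nat -> Q -> Prop)
    (C : Type) n (const : C -> Q) (env : 'I_n -> Q) t i :
  filtration P -> (forall q, P i (const q)) -> (forall k, P i (env k)) ->
  P i (eval const env t).
Proof.
move=> HP pc pe; elim: t => //= [|s IHs t IHt|s IHs t IHt|s IHs t IHt].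
- exact: fil1.
- exact: filM.
- exact: filD.
- exact: filR.
Qed.

(** * The filtration with trivial fourth level *)

Definition commutes_cm (Q : loopType) (m : Q) : Prop :=
  forall u v, m * cm u v = cm u v * m.

(* The second term of the filtration. Quantifying over the centralizer of the
   commutators, which will contain [term2] itself, makes [term2] commutative. *)
Definition term2 (Q : loopType) (n : Q) : Prop :=
  [/\ nuclear n, forall x, central (cm n x)
    & forall m, commutes_cm m -> n * m = m * n].

(** Levels 2 and 3 are cut out by properties rather than generated by commutators and associators,
    so no generated subloops have to be handled. *)
Definition lcs (Q : loopType) (i : nat) (x : Q) : Prop :=
  match i with
  | 0 | 1 => True
  | 2 => term2 x
  | 3 => central x
  | _ => x = 1
  end.

Section Lcs.
Variables (Q : loopType) (HQ : nil3 Q).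
Implicit Types x y z n m : Q.

Lemma cm_central1 z x : central z -> cm z x = 1.
Proof. by move=> [_ cz]; apply/cm_eq1. Qed.

Lemma central_term2 z : central z -> term2 z.
Proof.
move=> cz; split=> [|x|m _]; [by case: cz | | by case: cz].
by rewrite cm_central1 //; exact: central1.
Qed.

Lemma cm_term2 x y : term2 (cm x y).
Proof.
split=> [|z|m cm_m]; [exact: cm_nuclear | exact: cmc_central |].
by rewrite cm_m.
Qed.

Lemma term2_cm_cm n : term2 n -> commutes_cm n.
Proof. by move=> [_ _ c] u v; apply: c => s t; exact: cm_comm. Qed.

Lemma term2_comm n m : term2 n -> term2 m -> n * m = m * n.
Proof. by move=> [_ _ c] /term2_cm_cm /c. Qed.

Lemma term2M n m : term2 n -> term2 m -> term2 (n * m).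
Proof.
move=> [nn zn cn] [nm zm c_m]; split=> [|x|k hk].
- exact: nuclearM.
(* In [cmMl] the iterated commutator vanishes because [cm n x] is central; the other factors are
   central. *)
- rewrite (cmMl HQ) (cm_central1 _ (zn x)) mul1q.
  by do ![apply: centralM => // | exact: asc_central HQ _ _ _].
- by apply: commM; [| exact: cn | exact: c_m].
Qed.

Lemma term2V n : term2 n -> term2 (rinv n).
Proof.
move=> [nn zn cn]; split=> [|x|k hk].
- exact: nuclearV HQ _ nn.
(* Expand [cm (n * rinv n) x], which is 1, and solve for [cm (rinv n) x]. *)
- have := cmMl HQ n (rinv n) x.
  rewrite mulqV (cm_central1 _ (central1 Q)) (cm_central1 _ (zn x)) mul1q.
  set t := _ * (_ * asc x n _).
  have ct : central t.
    by do ![apply: centralM => // | exact: asc_central HQ _ _ _].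
  move=> /esym /rinv_uniq e.
  have -> : cm (rinv n) x = rinv (cm n x) * rinv t.
    by rewrite -e (nucl _ _ (cm_nuclear HQ _ _)) mulqV mulq1.
  by apply: centralM; exact: centralV.
- by apply: commV => //; exact: cn.
Qed.

Lemma lcs_le2 i x : i <= 2 -> term2 x -> lcs i x.
Proof. by case: i => [|[|[|]]]. Qed.

Lemma lcs_ge2 i x : 1 < i -> lcs i x -> term2 x.
Proof.
case: i => [|[|[|[|i]]]] //= _; first exact: central_term2.
by move=> ->; exact/central_term2/central1.
Qed.

Lemma lcs_le3 i x : i <= 3 -> central x -> lcs i x.
Proof. by case: i => [|[|[|[|]]]] //= _; exact: central_term2. Qed.

Lemma lcs_ge3 i x : 2 < i -> lcs i x -> central x.
Proof. by case: i => [|[|[|[|i]]]] //= _ ->; exact: central1. Qed.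

Lemma lcs_1 i : lcs i (1 : Q).
Proof.
case: i => [|[|[|[|i]]]] //=; last exact: central1.
exact/central_term2/central1.
Qed.

Lemma lcs_filtration : filtration (@lcs Q).
Proof.
split.
- move=> i j x ji px.
  case: (leqP j 1) => [|j1]; first by case: j {ji} => [|[]].
  have := lcs_ge2 (leq_trans j1 ji) px.
  move: j1; rewrite leq_eqVlt => /predU1P[<- //|j2 _].
  have := lcs_ge3 (leq_trans j2 ji) px.
  move: j2; rewrite leq_eqVlt => /predU1P[<- //|j3 _].
  move: (leq_trans j3 ji) px.
  by case: i {ji} => [|[|[|[|i]]]] //= _ ->; exact: lcs_1.
- exact: lcs_1.
- case=> [|[|[|[|i]]]] x y //=; [exact: term2M | exact: centralM |].
  by move=> -> ->; rewrite mul1q.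
- case=> [|[|[|[|i]]]] x //=; [exact: term2V | exact: centralV |].
  by move=> ->; symmetry; apply: rinv_uniq; rewrite mul1q.
- move=> i j k x y le_k px py.
  case: (leqP k 2) => [k2|k2]; first exact/lcs_le2/cm_term2.
  case: (leqP i 2) => i2; last first.
    by rewrite (cm_central1 _ (lcs_ge3 i2 px)); exact: lcs_1.
  case: (leqP j 2) => j2; last first.
    have [_ cy] := lcs_ge3 j2 py.
    by have -> : cm x y = 1 by [apply/cm_eq1]; exact: lcs_1.
  case: (leqP i 1) => i1; last first.
    have tx := lcs_ge2 i1 px.
    case: (leqP j 1) => j1.
      by apply: lcs_le3; [lia | case: tx].
    have -> : cm x y = 1 by apply/cm_eq1/term2_comm => //; exact: lcs_ge2 py.
    exact: lcs_1.
  (* The remaining case is [i = 1], [j = 2], [k = 3]; the clause of [term2] concerns [cm y x], the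
     inverse of [cm x y]. *)
  have [_ cy _] : term2 y by apply: lcs_ge2 py; lia.
  apply: lcs_le3; first lia.
  by rewrite (rinv_uniq (cmV HQ y x)); exact: centralV.
- move=> i j l k x y z le_k px py pz.
  have a1 : asc x y z = 1 -> lcs k (asc x y z) by move=> ->; exact: lcs_1.
  (* An argument of level at least 2 is nuclear and kills the associator; otherwise [k] is at most 3
     and a central value suffices. *)
  case: (leqP i 1) => i1; last first.
    have [/nuclear_asc nx _ _] := lcs_ge2 i1 px.
    by apply: a1; case: (nx y z).
  case: (leqP j 1) => j1; last first.
    have [/nuclear_asc ny _ _] := lcs_ge2 j1 py.
    by apply: a1; case: (ny x z).
  case: (leqP l 1) => l1; last first.
    have [/nuclear_asc nz _ _] := lcs_ge2 l1 pz.
    by apply: a1; case: (nz x y).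
  by apply: lcs_le3; [lia | exact: asc_central].
Qed.

End Lcs.

(** * Differences over a four-dimensional cube of arguments *)

Lemma ldivqq (Q : loopType) (x : Q) : ldiv x x = 1.
Proof. exact/ldiv_eq1. Qed.

Lemma ldiv1q (Q : loopType) (x : Q) : ldiv 1 x = x.
Proof. by rewrite -[LHS]mul1q mulqK. Qed.

Definition diag (T : Type) (x : T) := (x, x).

Lemma nil3_supernilpotent (Q : loopType) : nil3 Q -> supernilpotent 3 Q.
Proof.
move=> H1 n p e e0 lt3n abs_p; exists e0 => a.
(* The k-th coordinate of the 4-cube switches the k-th argument from [e] to [a]. *)
pose env (i : 'I_n) : (((Q * Q) * (Q * Q)) * ((Q * Q) * (Q * Q))) *
    (((Q * Q) * (Q * Q)) * ((Q * Q) * (Q * Q))) :=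
  match val i with
  | 0 => diag (diag (diag (e i, a i)))
  | 1 => diag (diag (diag (e i), diag (a i)))
  | 2 => diag (diag (diag (e i)), diag (diag (a i)))
  | 3 => (diag (diag (diag (e i))), diag (diag (diag (a i))))
  (* Any further argument is frozen at [a], so the last vertex carries the whole tuple [a]. *)
  | _ => diag (diag (diag (diag (a i))))
  end.
have H2 := nil3_pair H1 H1; have H4 := nil3_pair H2 H2.
have H8 := nil3_pair H4 H4; have H16 := nil3_pair H8 H8.
have F1 := lcs_filtration H1; have F2 := cube_filtration H1 F1.
have F4 := cube_filtration H2 F2; have F8 := cube_filtration H4 F4.
have F16 := cube_filtration H8 F8.
have FE : cube (cube (cube (cube (@lcs Q)))) 0
    (eval (fun q => diag (diag (diag (diag q)))) env p).
  apply: (fil_eval H16 _ F16) => [q|i].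
    by do ![apply: cube_diag => //].
  (* Switching an argument moves it by [ldiv (e i) (a i)], which lies in level 1 because that level
     is all of [Q]. *)
  rewrite /env; case: (val i) => [|[|[|[|_]]]].
  - by do 3!apply: cube_diag => //; apply/cubeE.
  - by do 2!apply: cube_diag => //; apply/cubeE; split; do ![apply: cube_diag => //].
  - by apply: cube_diag => //; apply/cubeE; split; do ![apply: cube_diag => //].
  - by apply/cubeE; split; do ![apply: cube_diag => //].
  - by do 4!apply: cube_diag => //.
have V c' env' : c' =1 id -> (exists i, env' i = e i) -> eval c' env' p = e0.
  move=> ec ee; rewrite (eq_eval p ec (fun=> erefl)).
  exact: abs_p.
pose i0 := Ordinal (ltn_trans (isT : 0 < 3) lt3n).
pose i1 := Ordinal (ltn_trans (isT : 1 < 3) lt3n).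
pose i2 := Ordinal (ltn_trans (isT : 2 < 3) lt3n).
pose i3 := Ordinal lt3n.
move: FE; rewrite !eval_pair.
(* At every vertex but the last, one of the first four arguments still equals its entry of [e]. *)
do 15![rewrite V; [|by []|
  by first [exists i0; reflexivity | exists i1; reflexivity
           |exists i2; reflexivity | exists i3; reflexivity]]].
rewrite (@eq_eval _ _ _ _ id _ a) //; last first.
  by move=> i; rewrite /env /=; case: (val i) => [|[|[|[|]]]].
(* Four differences reach level 4, which is trivial; quotients of equal entries are 1, so what
   remains is [ldiv e0] of the last value. *)
do 4![move=> /cubeE [_]].
rewrite /=.
by rewrite !(ldivqq, ldiv1q) => /ldiv_eq1.
Qed.

(** * Substitution and absorbing polynomials in four variables *)

Fixpoint subst (C : Type) (n m : nat) (s : 'I_n -> term C m) (t : loop_term n) :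
    term C m :=
  match t with
  | Var i => s i
  | Const v => of_void _ v
  | One => One
  | Mul t1 t2 => Mul (subst s t1) (subst s t2)
  | LDiv t1 t2 => LDiv (subst s t1) (subst s t2)
  | RDiv t1 t2 => RDiv (subst s t1) (subst s t2)
  end.

Definition subst2 C m (t : loop_term 2) (s1 s2 : term C m) :=
  subst (tnth [tuple s1; s2]) t.

Definition subst3 C m (t : loop_term 3) (s1 s2 s3 : term C m) :=
  subst (tnth [tuple s1; s2; s3]) t.

Section Substitution.
Variables (Q : loopType) (C : Type) (m : nat) (const : C -> Q) (env : 'I_m -> Q).

Lemma eval_subst n (s : 'I_n -> term C m) t :
  eval const env (subst s t) = eval (of_void Q) (fun i => eval const env (s i)) t.
Proof. by elim: t => //= t1 -> t2 ->. Qed.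

Lemma eval_subst2 t s1 s2 : eval const env (subst2 t s1 s2) =
  eval2 t (eval const env s1) (eval const env s2).
Proof. by rewrite eval_subst; apply: eq_eval => // -[[|[|]]]. Qed.

Lemma eval_subst3 t s1 s2 s3 : eval const env (subst3 t s1 s2 s3) =
  eval3 t (eval const env s1) (eval const env s2) (eval const env s3).
Proof. by rewrite eval_subst; apply: eq_eval => // -[[|[|[|]]]]. Qed.

End Substitution.

Local Notation X0 := (Var (@Ordinal 4 0 isT)).
Local Notation X1 := (Var (@Ordinal 4 1 isT)).
Local Notation X2 := (Var (@Ordinal 4 2 isT)).
Local Notation X3 := (Var (@Ordinal 4 3 isT)).

(** Supernilpotence makes [p] constant, and its value with all arguments 1 is 1. Describing [p] by
    [F] lets absorption be checked on loop elements. *)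
Lemma supernilpotent3_absorbing (Q : loopType) (p : polynomial Q 4)
    (F : Q -> Q -> Q -> Q -> Q) :
    supernilpotent 3 Q ->
    (forall env, peval p env =
      F (peval X0 env) (peval X1 env) (peval X2 env) (peval X3 env)) ->
    (forall x y z, F 1 x y z = 1) -> (forall x y z, F x 1 y z = 1) ->
    (forall x y z, F x y 1 z = 1) -> (forall x y z, F x y z 1 = 1) ->
  forall x y z t, F x y z t = 1.
Proof.
move=> HQ pF F0 F1 F2 F3 x y z t.
have [env [i ei]|q pq] := HQ 4 p (fun _ => 1) 1 isT.
  rewrite pF /peval /=; case: i ei => -[|[|[|[|//]]]] i;
    by rewrite (bool_irrelevance i isT) => ->.
have := pq (tnth [tuple x; y; z; t]); rewrite pF => ->.
by have := pq (fun _ => 1); rewrite pF F0.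
Qed.

(** * Identities for arbitrary commutator and associator terms *)

Section CommutatorAssociatorTerms.
Variables (c : loop_term 2) (a : loop_term 3).
Hypotheses (Hc : commutator_term c) (Ha : associator_term a).
Variable Q : loopType.
Implicit Types x y z : Q.

(** Since 1 commutes and associates with everything, these terms absorb 1, and so do their
    nestings. *)
Lemma eval2_1l x : eval2 c 1 x = 1.
Proof. by apply/Hc; rewrite mul1q mulq1. Qed.

Lemma eval2_1r x : eval2 c x 1 = 1.
Proof. by apply/Hc; rewrite mul1q mulq1. Qed.

Lemma eval3_1l x y : eval3 a 1 x y = 1.
Proof. by apply/Ha; rewrite !mul1q. Qed.

Lemma eval3_1m x y : eval3 a x 1 y = 1.
Proof. by apply/Ha; rewrite mul1q mulq1. Qed.

Lemma eval3_1r x y : eval3 a x y 1 = 1.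
Proof. by apply/Ha; rewrite !mulq1. Qed.

Let eval_1 := (eval2_1l, eval2_1r, eval3_1l, eval3_1m, eval3_1r,
  @mul1q Q, @mulq1 Q, @ldivqq Q, @ldiv1q Q).
Let eval_s := (@eval_subst2 Q Q 4 id, @eval_subst3 Q Q 4 id).

Ltac absorb abs p F :=
  by apply: (abs p F) => *; rewrite ?/peval /= ?eval_s ?eval_1.

Local Notation C := (eval2 c).
Local Notation A := (eval3 a).

Lemma supernilpotent3_identities : supernilpotent 3 Q -> satisfies_identities Q c a.
Proof.
rewrite /satisfies_identities /= => HQ x y u v w.
pose K (q : Q) : term Q 4 := Const q.
pose Ct := @subst2 Q 4 c; pose At := @subst3 Q 4 a.
have abs p F pF F0 F1 F2 F3 :=
  @supernilpotent3_absorbing Q p F HQ pF F0 F1 F2 F3 x y u v.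
split; first symmetry.
  absorb abs (Ct X0 (At X1 X2 X3)) (fun x y u v => C x (A y u v)).
split; first (split; [|split]; symmetry).
- absorb abs (At X0 X1 (At X2 X3 (K w))) (fun x y u v => A x y (A u v w)).
- absorb abs (At X0 (At X2 X3 (K w)) X1) (fun x y u v => A x (A u v w) y).
- absorb abs (At (At X2 X3 (K w)) X0 X1) (fun x y u v => A (A u v w) x y).
split; first (split; [|split]; symmetry).
- absorb abs (At X0 X1 (Ct X2 X3)) (fun x y u v => A x y (C u v)).
- absorb abs (At X0 (Ct X2 X3) X1) (fun x y u v => A x (C u v) y).
- absorb abs (At (Ct X2 X3) X0 X1) (fun x y u v => A (C u v) x y).
split; first (split; symmetry).
- absorb abs (Ct X0 (Ct X1 (Ct X2 X3))) (fun x y u v => C x (C y (C u v))).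
- absorb abs (Ct X0 (Ct (Ct X2 X3) X1)) (fun x y u v => C x (C (C u v) y)).
split; first (split; symmetry).
- absorb abs (Ct (Ct X1 (Ct X2 X3)) X0) (fun x y u v => C (C y (C u v)) x).
- absorb abs (Ct (Ct (Ct X2 X3) X1) X0) (fun x y u v => C (C (C u v) y) x).
split; first symmetry.
  absorb abs (Ct (Ct X0 X1) (Ct X2 X3)) (fun x y u v => C (C x y) (C u v)).
(* The quotient of the two sides absorbs 1: if [x] or [y] is 1 the sides coincide, and if [u] or [v]
   is 1 all associators are 1. *)
split; [|split]; apply/esym/ldiv_eq1.
- absorb abs
    (LDiv (Mul (At X0 X2 X3) (At X1 X2 X3)) (At (Mul X0 X1) X2 X3))
    (fun x y u v => ldiv (A x u v * A y u v) (A (x * y) u v)).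
- absorb abs
    (LDiv (Mul (At X2 X0 X3) (At X2 X1 X3)) (At X2 (Mul X0 X1) X3))
    (fun x y u v => ldiv (A u x v * A u y v) (A u (x * y) v)).
- absorb abs
    (LDiv (Mul (At X2 X3 X0) (At X2 X3 X1)) (At X2 X3 (Mul X0 X1)))
    (fun x y u v => ldiv (A u v x * A u v y) (A u v (x * y))).
Qed.

End CommutatorAssociatorTerms.

Theorem theorem5p7 (Q : loopType) :
  (supernilpotent 3 Q <->
     (forall (c : loop_term 2) (a : loop_term 3),
        commutator_term c -> associator_term a -> satisfies_identities Q c a))
  /\
  ((forall (c : loop_term 2) (a : loop_term 3),
      commutator_term c -> associator_term a -> satisfies_identities Q c a) <->
   satisfies_identities Q std_commutator std_associator).
Proof.
have i_ii : supernilpotent 3 Q -> forall c a, commutator_term c ->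
    associator_term a -> satisfies_identities Q c a.
  by move=> HQ c a Hc Ha; exact: supernilpotent3_identities.
have ii_iii : (forall c a, commutator_term c -> associator_term a ->
    satisfies_identities Q c a) ->
    satisfies_identities Q std_commutator std_associator.
  apply=> [L a b|L a b c]; first exact: cm_eq1.
  by split=> [/asc_eq1|/esym/asc_eq1].
have iii_i : satisfies_identities Q std_commutator std_associator ->
    supernilpotent 3 Q.
  by move=> /nil3P; exact: nil3_supernilpotent.
by split; split; auto.
Qed.
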